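(* For every positive integer $n\neq 5$, the maximum number of edges in an $n$-vertex graph containing no subgraph isomorphic to $P^2_6$ is $$\mathrm{ex}(n,P^2_6)=\begin{cases}\left\lfloor \frac{n^2}{4}\right\rfloor+\left\lfloor\frac{n-1}{2}\right\rfloor, & n\equiv 1,2,3 \pmod 6,\\[2pt] \left\lfloor \frac{n^2}{4}\right\rfloor+\left\lceil\frac{n}{2}\right\rceil, & \text{otherwise.}\end{cases}$$
   Context: All graphs are finite, simple and undirected. $P^2_k$ is the square of the path on $k$ vertices $v_1,\dots,v_k$: $v_i,v_j$ adjacent iff $1\le |i-j|\le 2$. $\mathrm{ex}(n,H)$ is the maximum number of edges in an $n$-vertex graph not containing $H$ as a subgraph. *)

(* Defs.v *)
From mathcomp Require Import all_boot ssrint.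
Set Implicit Arguments.
Unset Strict Implicit.
Unset Printing Implicit Defensive.

Record sgraph := SGraph {
  vertex :> finType;
  adj : rel vertex;
  adj_sym : symmetric adj;
  adj_irr : irreflexive adj }.

Definition edges (G : sgraph) : {set {set G}} :=
  [set [set x; y] | x in G, y in adj x].

(* Subgraphs need not be induced: only edges have to be preserved. *)
Definition has_copy (H G : sgraph) : Prop :=
  exists f : H -> G, injective f /\ forall x y : H, adj x y -> adj (f x) (f y).

(* m = ex(n, H): m is the largest size of an H-free graph of order n. The
   relational form includes the existence of an H-free graph with m edges. *)
Definition is_ex (n : nat) (H : sgraph) (m : nat) : Prop :=
  (exists G : sgraph, [/\ #|G| = n, ~ has_copy H G & #|edges G| = m]) /\
  (forall G : sgraph, #|G| = n -> ~ has_copy H G -> #|edges G| <= m).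

Definition sqpath_adj (k : nat) : rel 'I_k :=
  fun i j => 1 <= `|i - j|%N <= 2.

Lemma sqpath_adj_sym (k : nat) : symmetric (@sqpath_adj k).
Proof. by move=> i j; rewrite /sqpath_adj distnC. Qed.

Lemma sqpath_adj_irr (k : nat) : irreflexive (@sqpath_adj k).
Proof. by move=> i; rewrite /sqpath_adj distnn. Qed.

(* The vertices v_1, ..., v_k are indexed from 0. *)
Definition sqpath (k : nat) : sgraph :=
  SGraph (@sqpath_adj_sym k) (@sqpath_adj_irr k).

(* Main.v *)
(* Upper bound: take a smallest counterexample on n > 6 vertices. Deleting one
   vertex forces every degree above n/2, so adjacent vertices have common
   neighbours, and a copy v1 ... v5 of the square of P_5 appears greedily; as it
   does not extend, all common neighbours of v4 and v5 lie in {v1, v2, v3}.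
   - n = 3, 4, 5 (mod 6): adjacent vertices have three common neighbours, so v1
     ... v5 is a K_5. An outside vertex sees at most one of its vertices, and
     the degree sum is too small.
   - n = 0, 2 (mod 6): one finds K_5 minus an edge, with all inequalities tight.
     This yields a triangle completely joined to three independent vertices, all
     six of degree n/2 + 1; deleting them contradicts minimality.
   - n = 1 (mod 6): deleting sets of at most five vertices shows that there is a
     vertex h of degree above the minimum, no K_4, and that v1, v2, v4, v5
     always have minimum degree. The neighbourhood of h then contains a 4-cycle
     of vertices of minimum degree, whose deletion contradicts minimality.
   Lower bound: the join of an independent set and a disjoint union of triangles
   (and possibly an isolated vertex) in suitable proportions. *)

Require Import Defs.
From mathcomp Require Import all_boot.
From mathcomp Require Import zify.

Set Implicit Arguments.
Unset Strict Implicit.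
Unset Printing Implicit Defensive.

(** * The extremal function, residue by residue *)

Definition sqp_ex n :=
  if n %% 6 \in [:: 1; 2; 3] then n ^ 2 %/ 4 + (n - 1) %/ 2
  else n ^ 2 %/ 4 + uphalf n.

(** These closed forms remove the floors: once n^2 is a multiple of 4 plus 0 or 1, the quotient is
    explicit, and later comparisons are polynomial arithmetic in [q]. *)
Lemma sqp_ex0 q : sqp_ex (6 * q) = 9 * (q * q) + 3 * q.
Proof.
rewrite /sqp_ex !inE mulnC modnMl /= uphalfE -divn2.
have -> : (q * 6) ^ 2 = 9 * (q * q) * 4 by rewrite expnS expn1; nia.
rewrite mulnK //; lia.
Qed.

Lemma sqp_ex1 q : sqp_ex (6 * q + 1) = 9 * (q * q) + 6 * q.
Proof.
rewrite /sqp_ex !inE mulnC modnMDl /=.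
have -> : (q * 6 + 1) ^ 2 = (9 * (q * q) + 3 * q) * 4 + 1 by rewrite expnS expn1; nia.
rewrite divnMDl //; lia.
Qed.

Lemma sqp_ex2 q : sqp_ex (6 * q + 2) = 9 * (q * q) + 9 * q + 1.
Proof.
rewrite /sqp_ex !inE mulnC modnMDl /=.
have -> : (q * 6 + 2) ^ 2 = (9 * (q * q) + 6 * q + 1) * 4 by rewrite expnS expn1; nia.
rewrite mulnK //; lia.
Qed.

Lemma sqp_ex3 q : sqp_ex (6 * q + 3) = 9 * (q * q) + 12 * q + 3.
Proof.
rewrite /sqp_ex !inE mulnC modnMDl /=.
have -> : (q * 6 + 3) ^ 2 = (9 * (q * q) + 9 * q + 2) * 4 + 1 by rewrite expnS expn1; nia.
rewrite divnMDl //; lia.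
Qed.

Lemma sqp_ex4 q : sqp_ex (6 * q + 4) = 9 * (q * q) + 15 * q + 6.
Proof.
rewrite /sqp_ex !inE mulnC modnMDl /= uphalfE -divn2.
have -> : (q * 6 + 4) ^ 2 = (9 * (q * q) + 12 * q + 4) * 4 by rewrite expnS expn1; nia.
rewrite mulnK //; lia.
Qed.

Lemma sqp_ex5 q : sqp_ex (6 * q + 5) = 9 * (q * q) + 18 * q + 9.
Proof.
rewrite /sqp_ex !inE mulnC modnMDl /= uphalfE -divn2.
have -> : (q * 6 + 5) ^ 2 = (9 * (q * q) + 15 * q + 6) * 4 + 1 by rewrite expnS expn1; nia.
rewrite divnMDl //; lia.
Qed.

(** * Degree sums and common neighbours *)

Section Counting.

Variables (T : finType) (e : rel T).
Hypotheses (e_sym : symmetric e) (e_irr : irreflexive e).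
Implicit Types (A : {set T}) (s : seq T).

Definition degree A x := \sum_(y in A) (e x y : nat).

Definition total_degree A := \sum_(x in A) degree A x.

(** Twice the number of edges spanned by [s], as [total_degree] is for a set; on an explicit list it
    unfolds into adjacency bits. *)
Definition list_degree s := \sum_(x <- s) \sum_(y <- s) (e x y : nat).

Lemma big_set_seq (s : seq T) (F : T -> nat) : uniq s ->
  \sum_(x in [set x in s]) F x = \sum_(x <- s) F x.
Proof.
move=> us; rewrite big_uniq //=; apply: eq_bigl => x; by rewrite inE.
Qed.

Lemma card_set_seq s : uniq s -> #|[set x in s]| = size s.
Proof. by move=> us; rewrite cardsE; apply/card_uniqP. Qed.

Lemma sum_set_split A s (F : T -> nat) : uniq s -> {subset s <= A} ->
  \sum_(x in A) F x = \sum_(x <- s) F x + \sum_(x in A :\: [set x in s]) F x.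
Proof.
move=> us sA; rewrite (big_setID [set x in s]) /= -big_set_seq //; congr (_ + _).
apply: eq_bigl => x; rewrite !inE; case: (boolP (x \in s)) => xs; last by rewrite andbF.
by rewrite (sA _ xs).
Qed.

Lemma sum_degree A s :
  \sum_(x <- s) degree A x = \sum_(w in A) \sum_(x <- s) (e w x : nat).
Proof.
rewrite exchange_big /=; apply: eq_bigr => w _; apply: eq_bigr => x _.
by rewrite e_sym.
Qed.

(** The degrees over [s] count an edge leaving [s] once but an edge inside [s] twice; the term
    [list_degree s] corrects for this. *)
Lemma total_degreeD A s : uniq s -> {subset s <= A} ->
  total_degree A + list_degree s =
  total_degree (A :\: [set x in s]) + 2 * \sum_(x <- s) degree A x.
Proof.
move=> us sA; set B := A :\: _.
have dA x : degree A x = \sum_(y <- s) (e x y : nat) + degree B x.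
  exact: sum_set_split.
rewrite /total_degree (sum_set_split _ us sA) -/B.
have -> : \sum_(x in B) degree A x = \sum_(x <- s) degree B x + total_degree B.
  rewrite sum_degree /total_degree -big_split /=; apply: eq_bigr => x _.
  by rewrite dA.
have -> : \sum_(x <- s) degree A x = list_degree s + \sum_(x <- s) degree B x.
  by rewrite /list_degree -big_split /=; apply: eq_bigr => x _; rewrite dA.
rewrite /total_degree; lia.
Qed.

(** Inclusion and exclusion, vertex by vertex: large degrees force common neighbours. *)
Lemma degree_codegree A x z :
  degree A x + degree A z + \sum_(y in A) (~~ e x y && ~~ e z y : nat) =
  #|A| + \sum_(y in A) (e x y && e z y : nat).
Proof.
rewrite -sum1_card /degree -!big_split /=; apply: eq_bigr => y _.
by case: (e x y); case: (e z y).
Qed.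

Lemma sum_le_seq A s (F : T -> nat) :
  (forall y, y \in A -> y \notin s -> F y = 0) ->
  \sum_(y in A) F y <= \sum_(y <- s) F y.
Proof.
elim: s A => [|x s IHs] A F0; first by rewrite big1 // => y yA; apply: F0.
rewrite big_cons; have [xA|xA] := boolP (x \in A).
  rewrite (big_setD1 x) //= leq_add2l; apply: IHs => y.
  by rewrite !inE => /andP[yx yA] ys; apply: F0; rewrite ?inE ?negb_or ?yx.
apply: leq_trans (leq_addl _ _); apply: IHs => y yA ys; apply: F0 => //.
by rewrite inE negb_or ys andbT; apply: contraNneq xA => <-.
Qed.

Lemma codegree_le A s x z : (forall y, y \in A -> e x y -> e z y -> y \in s) ->
  degree A x + degree A z <= #|A| + \sum_(y <- s) (e x y && e z y : nat).
Proof.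
move=> sub.
apply: leq_trans (leq_addr (\sum_(y in A) (~~ e x y && ~~ e z y : nat)) _) _.
rewrite degree_codegree leq_add2l.
apply: sum_le_seq => y yA ys; apply/eqP; rewrite eqb0; apply: contra ys.
by case/andP; apply: sub.
Qed.

Lemma codegree_lt A s x z w : w \in A -> ~~ e x w -> ~~ e z w ->
  (forall y, y \in A -> e x y -> e z y -> y \in s) ->
  degree A x + degree A z < #|A| + \sum_(y <- s) (e x y && e z y : nat).
Proof.
move=> wA xw zw sub.
apply: (@leq_trans (#|A| + \sum_(y in A) (e x y && e z y : nat))).
  rewrite -degree_codegree -addn1 leq_add2l (big_setD1 w) //= xw zw; exact: leq_addr.
rewrite leq_add2l; apply: sum_le_seq => y yA ys; apply/eqP; rewrite eqb0.
by apply: contra ys; case/andP; apply: sub.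
Qed.

Lemma codegree_exists A s x z :
  #|A| + \sum_(y <- s) (e x y && e z y : nat) < degree A x + degree A z ->
  exists y, [/\ y \in A, y \notin s, e x y & e z y].
Proof.
move=> lt_d; case: (boolP [exists y in A, [&& y \notin s, e x y & e z y]]).
  by case/exists_inP => y yA /and3P[ys xy zy]; exists y.
rewrite negb_exists_in => /forall_inP none; move: lt_d; rewrite ltnNge codegree_le //.
by move=> y yA xy zy; have := none y yA; rewrite xy zy !andbT negbK.
Qed.

Lemma degree_exists A s x : \sum_(y <- s) (e x y : nat) < degree A x ->
  exists y, [/\ y \in A, y \notin s & e x y].
Proof.
move=> lt_d; case: (boolP [exists y in A, (y \notin s) && e x y]).
  by case/exists_inP => y yA /andP[ys xy]; exists y.
rewrite negb_exists_in => /forall_inP none; move: lt_d; rewrite ltnNge sum_le_seq //.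
move=> y yA ys; apply/eqP; rewrite eqb0; apply: contra (none y yA) => xy.
by rewrite ys.
Qed.

Lemma list_degree_cons x s :
  list_degree (x :: s) = list_degree s + 2 * \sum_(y <- s) (e x y : nat).
Proof.
have D : \sum_(z <- s) \sum_(y <- x :: s) (e z y : nat) =
    \sum_(y <- s) (e x y : nat) + list_degree s.
  by rewrite /list_degree -big_split; apply: eq_bigr => z _; rewrite big_cons e_sym.
by rewrite /list_degree big_cons D big_cons e_irr /list_degree; lia.
Qed.

(** The degree sum counts edges inside [s] twice, plus at most one edge from each of the
    [#|A| - size s] other vertices. *)
Lemma sum_degree_le A s : uniq s -> {subset s <= A} ->
  (forall w, w \in A -> w \notin s -> \sum_(x <- s) (e w x : nat) <= 1) ->
  \sum_(x <- s) degree A x + size s <= list_degree s + #|A|.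
Proof.
move=> us sA le1; rewrite sum_degree (sum_set_split _ us sA) -/(list_degree s).
rewrite -addnA leq_add2l -(cardsID [set x in s] A).
have -> : A :&: [set x in s] = [set x in s].
  by apply/setIidPr/subsetP => x; rewrite inE => /sA.
rewrite card_set_seq // addnC leq_add2l -sum1_card; apply: leq_sum => w.
by rewrite !inE => /andP[ws wA]; apply: le1.
Qed.

End Counting.

(** * Squares of paths and cliques in a critical graph *)

Definition sqpath6_free (T : finType) (e : rel T) :=
  forall a b c d x y, uniq [:: a; b; c; d; x; y] ->
  ~~ [&& e a b, e a c, e b c, e b d, e c d, e c x, e d x, e d y & e x y].

(** Disequalities are listed only for pairs at distance 3 or more; the other pairs are distinct by
    adjacency. *)
Definition sqpath5 (T : finType) (e : rel T) a b c d x :=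
  [/\ [/\ e a b, e a c & e b c], [/\ e b d, e c d, e c x & e d x]
    & [/\ a != d, a != x & b != x]].

(* [crit] is what a smallest counterexample satisfies: the edges of [A] exceed
   the bound, while those that survive the deletion of [s] do not. All edges of
   [e] lie inside [A], by [eA]. *)
Section Critical.

Variables (T : finType) (e : rel T) (A : {set T}).
Hypotheses (e_sym : symmetric e) (e_irr : irreflexive e).
Hypotheses (eA : forall x y, e x y -> x \in A) (free : sqpath6_free e).
Hypothesis crit : forall s, uniq s -> {subset s <= A} -> 0 < size s ->
  #|A| - size s != 5 ->
  2 * sqp_ex #|A| + list_degree e s <
    2 * sqp_ex (#|A| - size s) + 2 * \sum_(x <- s) degree e A x.

Local Notation d := (degree e A).

Lemma adj_neq x y : e x y -> x != y.
Proof. by apply: contraTneq => ->; rewrite e_irr. Qed.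

Lemma adj_mem_r x y : e x y -> y \in A.
Proof. by rewrite e_sym; apply: eA. Qed.

Lemma sqpath5_rev a b c u v : sqpath5 e a b c u v -> sqpath5 e v u c b a.
Proof.
case=> [[ab ac bc] [bu cu cv uv] [au av bv]]; split; split; by rewrite 1?e_sym 1?eq_sym.
Qed.

(** Any other [y] could be appended as a sixth vertex. *)
Lemma sqpath5_ext a b c u v y :
  sqpath5 e a b c u v -> e u y -> e v y -> y \in [:: a; b; c].
Proof.
case=> [[ab ac bc] [bu cu cv uv] [au av bv]] uy vy; apply/negPn/negP => yn.
suff us : uniq [:: a; b; c; u; v; y].
  by have := free us; rewrite ab ac bc bu cu cv uv uy vy.
move: yn; rewrite /= !inE !negb_or; case/and3P => ya yb yc.
rewrite au av bv !(adj_neq ab, adj_neq ac, adj_neq bc, adj_neq bu, adj_neq cu,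
  adj_neq cv, adj_neq uv, adj_neq uy, adj_neq vy) /=.
by rewrite !(eq_sym _ y) ya yb yc.
Qed.

Definition clique4 a b c u := [/\ e a b, e a c, e a u & [/\ e b c, e b u & e c u]].

Definition clique5 a b c u v := clique4 a b c u /\ [/\ e a v, e b v, e c v & e u v].

Lemma clique4_list a b c u : clique4 a b c u ->
  uniq [:: a; b; c; u] /\ {subset [:: a; b; c; u] <= A}.
Proof.
case=> ab ac au [bc bu cu]; split.
  by rewrite /= !inE !negb_or !(adj_neq ab, adj_neq ac, adj_neq au, adj_neq bc, adj_neq bu, adj_neq cu).
by apply/allP; rewrite /= (eA ab) (eA bc) (eA cu) (adj_mem_r cu).
Qed.

Ltac edge := first [assumption | by rewrite e_sym | by rewrite eq_sym
  | by apply: adj_neq; first [assumption | rewrite e_sym]].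

(** Any two vertices of a K_5 end some ordering of it as a square of a path, so an outside vertex
    sees at most one of the five; the edges inside contribute 20. *)
Lemma clique5_bound a b c u v : clique5 a b c u v ->
  d a + d b + d c + d u + d v <= #|A| + 15.
Proof.
move=> K; have [K4 [av bv cv uv]] := K.
have [us sA] := clique4_list K4.
have [ab ac au [bc bu cu]] := K4.
pose s := [:: v; a; b; c; u].
have us' : uniq s.
  rewrite /s cons_uniq us andbT !inE !negb_or ![v == _]eq_sym.
  by rewrite !(adj_neq av, adj_neq bv, adj_neq cv, adj_neq uv).
have sA' : {subset s <= A}.
  by apply/allP; rewrite /= (eA av) (eA bv) (eA cv) (eA uv) (adj_mem_r uv).
have le1 w : w \in A -> w \notin s -> \sum_(x <- s) (e w x : nat) <= 1.
  move=> _ ws.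
  have E p q r x y : sqpath5 e p q r x y -> {subset [:: p; q; r] <= s} ->
      ~~ (e w x && e w y).
    move=> P sub; apply: contra ws => /andP[wx wy].
    by apply: sub; apply: (sqpath5_ext P); rewrite e_sym.
  have S p q r : p \in s -> q \in s -> r \in s -> {subset [:: p; q; r] <= s}.
    by move=> ps qs rs; apply/allP; rewrite /= ps qs rs.
  have [sa sb sc su sv] : [/\ a \in s, b \in s, c \in s, u \in s & v \in s].
    by rewrite !inE !eqxx !orbT.
  have Eab : ~~ (e w a && e w b) by apply: (E c u v); [split; split; edge | exact: S].
  have Eac : ~~ (e w a && e w c) by apply: (E b u v); [split; split; edge | exact: S].
  have Eau : ~~ (e w a && e w u) by apply: (E b c v); [split; split; edge | exact: S].
  have Eav : ~~ (e w a && e w v) by apply: (E b c u); [split; split; edge | exact: S].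
  have Ebc : ~~ (e w b && e w c) by apply: (E a u v); [split; split; edge | exact: S].
  have Ebu : ~~ (e w b && e w u) by apply: (E a c v); [split; split; edge | exact: S].
  have Ebv : ~~ (e w b && e w v) by apply: (E a c u); [split; split; edge | exact: S].
  have Ecu : ~~ (e w c && e w u) by apply: (E a b v); [split; split; edge | exact: S].
  have Ecv : ~~ (e w c && e w v) by apply: (E a b u); [split; split; edge | exact: S].
  have Euv : ~~ (e w u && e w v) by apply: (E a b c); [split; split; edge | exact: S].
  rewrite !big_cons big_nil.
  by move: Eab Eac Eau Eav Ebc Ebu Ebv Ecu Ecv Euv;
    case: (e w a) (e w b) (e w c) (e w u) (e w v) => [] [] [] [] [].
have := sum_degree_le e_sym us' sA' le1.
rewrite !(list_degree_cons e_sym e_irr) /list_degree !big_cons !big_nil /=.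
rewrite !(e_sym v) ab ac au bc bu cu av bv cv uv => le_d; clear -le_d; lia.
Qed.

(** If every outside vertex saw at most one vertex of the K_4, the four degrees would sum to at most
    12 + ([#|A|] - 4). The K_4 is relabelled so that two vertices seen come last. *)
Lemma clique4_ext a b c u : clique4 a b c u -> #|A| + 8 < d a + d b + d c + d u ->
  exists p q r s w, [/\ clique4 p q r s, w \notin [:: p; q; r; s], e w r & e w s].
Proof.
move=> K lt_d; have [us sA] := clique4_list K.
have [ab ac au [bc bu cu]] := K.
pose s := [:: a; b; c; u].
case: (boolP [exists w in A, (w \notin s) && (1 < \sum_(x <- s) (e w x : nat))]); last first.
  rewrite negb_exists_in => /forall_inP none.
  have le1 w : w \in A -> w \notin s -> \sum_(x <- s) (e w x : nat) <= 1.
    by move=> wA ws; have := none w wA; rewrite ws -leqNgt.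
  have := sum_degree_le e_sym us sA le1.
  rewrite !(list_degree_cons e_sym e_irr) /list_degree !big_cons !big_nil /=.
  by rewrite ab ac au bc bu cu => le_d; clear -le_d lt_d; lia.
case/exists_inP => w wA /andP[ws]; rewrite !big_cons big_nil => gt1.
have P p q r t : e w r -> e w t -> clique4 p q r t ->
    (w \notin [:: a; b; c; u] -> w \notin [:: p; q; r; t]) ->
    exists p q r s w, [/\ clique4 p q r s, w \notin [:: p; q; r; s], e w r & e w s].
  by move=> wr wt Kp sub; exists p, q, r, t, w; split=> //; apply: sub.
case wa: (e w a) gt1; case wb: (e w b); case wc: (e w c); case wu: (e w u) => // _.
all: first [ apply: (P a b c u wc wu) | apply: (P a c b u wb wu) | apply: (P a u b c wb wc)
  | apply: (P b c a u wa wu) | apply: (P b u a c wa wc) | apply: (P c u a b wa wb) ];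
  first [ by split; [edge | edge | edge | split; edge]
        | by rewrite !inE !negb_or; case/and4P=> -> -> -> -> ].
Qed.

(** Adjacent vertices have two common neighbours, so one of them avoids the vertex just left
    behind. *)
Lemma exists_sqpath5 x : x \in A -> 4 < #|A| ->
  (forall y, y \in A -> #|A| + 2 <= 2 * d y) -> exists a b c u v, sqpath5 e a b c u v.
Proof.
move=> xA n_gt4 deg_ge.
have bool1 (b : bool) : (b : nat) <= 1 by case: b.
have [|y [yA _ xy]] := @degree_exists _ e A [::] x.
  by rewrite big_nil; move: (deg_ge _ xA) n_gt4; clear; lia.
have [|z [zA _ xz yz]] := @codegree_exists _ e A [::] x y.
  by rewrite big_nil; move: (deg_ge _ xA) (deg_ge _ yA) n_gt4; clear; lia.
have [|t [tA]] := @codegree_exists _ e A [:: x] y z.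
  rewrite big_cons big_nil addn0.
  by move: (deg_ge _ yA) (deg_ge _ zA) (bool1 (e y x && e z x)); clear; lia.
rewrite inE => tx yt zt.
have [|w [wA]] := @codegree_exists _ e A [:: y] z t.
  rewrite big_cons big_nil addn0.
  by move: (deg_ge _ zA) (deg_ge _ tA) (bool1 (e z y && e t y)); clear; lia.
rewrite inE => wy zw tw.
(* The fifth vertex may fall back on [x], which closes a K_4; [clique4_ext] then supplies a fifth
   vertex. *)
have [wx|wx] := eqVneq w x; last first.
  by exists x, y, z, t, w; split; split; edge.
have K : clique4 x y z t by subst w; split; [edge | edge | edge | split; edge].
have [|p [q [r [s [v]]]]] := clique4_ext K.
  by move: (deg_ge _ xA) (deg_ge _ yA) (deg_ge _ zA) (deg_ge _ tA) n_gt4; clear; lia.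
case=> [[pq pr ps [qr qs rs]]]; rewrite !inE !negb_or => /and4P[vp vq vr vs] v_r v_s.
by exists p, q, r, s, v; split; split; edge.
Qed.

(** * Residues 3, 4 and 5 *)

Lemma min_degree3_false : 6 < #|A| ->
  (forall y, y \in A -> #|A| + 3 <= 2 * d y) -> False.
Proof.
move=> n_gt6 deg_ge.
have [x xA] : exists x, x \in A by apply/card_gt0P; apply: leq_trans n_gt6.
have [//||a [b [c [u [v P]]]]] := exists_sqpath5 xA.
- by apply: leq_trans n_gt6.
- by move=> y /deg_ge; clear; lia.
have [[ab ac bc] [bu cu cv uv] [au av bv]] := P.
have := @codegree_le _ e A [:: a; b; c] u v (fun y _ => sqpath5_ext P (y := y)).
rewrite !big_cons big_nil (e_sym u b) bu (e_sym u c) cu (e_sym v c) cv /=.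
have [aA bA cA] := And3 (eA ab) (eA bc) (eA cv).
have [uA vA] := conj (eA uv) (adj_mem_r uv).
move: (deg_ge _ aA) (deg_ge _ bA) (deg_ge _ cA) (deg_ge _ uA) (deg_ge _ vA).
(* [u] and [v] have three common neighbours, necessarily [a], [b], [c], so all undecided pairs are
   edges and a K_5 appears. *)
case ua: (e u a); case va: (e v a); case vb: (e v b); try by clear -n_gt6; lia.
have K : clique5 a b c u v by split; [split; [edge | edge | edge | split; edge] | split; edge].
by have := clique5_bound K; clear -n_gt6; lia.
Qed.

(** * Residues 0 and 2 *)

Definition clique5_minus_edge x y a b c :=
  [/\ clique4 x a b c, [/\ e y a, e y b & e y c], x != y & ~~ e x y].

Lemma exists_clique5_minus_edge : 7 < #|A| ->
  (forall y, y \in A -> #|A| + 2 <= 2 * d y) ->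
  exists x y a b c, clique5_minus_edge x y a b c.
Proof.
move=> n_gt7 deg_ge.
have [x xA] : exists x, x \in A by apply/card_gt0P; apply: leq_trans n_gt7.
have [//||a [b [c [u [v P]]]]] := exists_sqpath5 xA; first by apply: leq_trans n_gt7.
  by move=> y /deg_ge; clear; lia.
have [[ab ac bc] [bu cu cv uv] [au av bv]] := P.
have := @codegree_le _ e A [:: a; b; c] u v (fun y _ => sqpath5_ext P (y := y)).
have := @codegree_le _ e A [:: v; u; c] b a
  (fun y _ => sqpath5_ext (sqpath5_rev P) (y := y)).
rewrite !big_cons !big_nil (e_sym u b) bu (e_sym u c) cu (e_sym v c) cv bc ac /=.
rewrite (e_sym a u) (e_sym b v) (e_sym a v).
have [aA bA cA] := And3 (eA ab) (eA bc) (eA cv).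
have [uA vA] := conj (eA uv) (adj_mem_r uv).
move: (deg_ge _ aA) (deg_ge _ bA) (deg_ge _ cA) (deg_ge _ uA) (deg_ge _ vA).
(* Two common neighbours for [u], [v] and, by reversal, for [a], [b] force at least two of the three
   undecided pairs to be edges; all three would give a K_5. *)
case ua: (e u a); case va: (e v a); case vb: (e v b); try by clear -n_gt7; lia.
- have K : clique5 a b c u v by split; [split; [edge | edge | edge | split; edge] | split; edge].
  by have := clique5_bound K; clear -n_gt7; lia.
- move=> *; exists b, v, a, c, u; split; [split; [edge|edge|edge|split; edge]|split; edge|edge|].
  by rewrite e_sym vb.
- move=> *; exists a, v, b, c, u; split; [split; [edge|edge|edge|split; edge]|split; edge|edge|].
  by rewrite e_sym va.
- move=> *; exists a, u, b, c, v; split; [split; [edge|edge|edge|split; edge]|split; edge|edge|].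
  by rewrite e_sym ua.
Qed.

(** The square path [y], [b], [c], [a], [x] leaves only [b] and [c] as common neighbours of [a] and
    [x]. Their degree sum then meets the codegree bound, so every other vertex sees exactly one of
    [a] and [x]. *)
Lemma clique5_minus_edge_tight x y a b c :
  (forall y, y \in A -> #|A| + 2 <= 2 * d y) -> clique5_minus_edge x y a b c ->
  [/\ 2 * d x = #|A| + 2, 2 * d a = #|A| + 2 &
      forall w, w \in A -> (e x w || e a w) && (e x w && e a w ==> (w \in [:: b; c]))].
Proof.
move=> deg_ge [[xa xb xc [ab ac bc]] [ya yb yc] xy nxy].
have P : sqpath5 e y b c a x by split; split; edge.
have sub w : w \in A -> e x w -> e a w -> w \in [:: b; c].
  move=> _ xw aw; have := sqpath5_ext P aw xw; rewrite in_cons.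
  by case: eqP => // wy; rewrite wy (negbTE nxy) in xw.
have := codegree_le sub; rewrite !big_cons big_nil xb xc ab ac /=.
move: (deg_ge _ (eA xa)) (deg_ge _ (eA ab)) => dx da dxa.
split; [clear -dx da dxa; lia | clear -dx da dxa; lia | move=> w wA].
apply/andP; split; last by apply/implyP => /andP[]; apply: sub.
have [//|] := boolP (e x w || e a w); rewrite negb_or => /andP[xw aw].
have := codegree_lt wA xw aw sub; rewrite !big_cons big_nil xb xc ab ac /=.
by clear -dx da; lia.
Qed.

(** By the third hypothesis, deleting six vertices of degree n/2 + 1 that span 12 edges is exactly
    neutral, against the strict inequality in [crit]; order 11 would lead to the exceptional order
    5. *)
Lemma even_false : 7 < #|A| -> #|A| != 11 ->
  2 * sqp_ex #|A| + 12 = 2 * sqp_ex (#|A| - 6) + 6 * #|A| ->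
  (forall y, y \in A -> #|A| + 2 <= 2 * d y) -> False.
Proof.
move=> n_gt7 n_neq11 ex6 deg_ge.
have [x [y [a [b [c K]]]]] := exists_clique5_minus_edge n_gt7 deg_ge.
have [[xa xb xc [ab ac bc]] [ya yb yc] xy nxy] := K.
have mk p q r s t : e p r -> e p s -> e p t -> e r s -> e r t -> e s t ->
    e q r -> e q s -> e q t -> p != q -> ~~ e p q -> clique5_minus_edge p q r s t.
  by move=> *; split=> //; split=> //; split.
have [dx da Na] := clique5_minus_edge_tight deg_ge K.
have [_ db Nb] : [/\ 2 * d x = #|A| + 2, 2 * d b = #|A| + 2 &
    forall w, w \in A -> (e x w || e b w) && (e x w && e b w ==> (w \in [:: a; c]))].
  by apply: (@clique5_minus_edge_tight x y) => //; apply: mk => //; edge.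
have [_ dc Nc] : [/\ 2 * d x = #|A| + 2, 2 * d c = #|A| + 2 &
    forall w, w \in A -> (e x w || e c w) && (e x w && e c w ==> (w \in [:: a; b]))].
  by apply: (@clique5_minus_edge_tight x y) => //; apply: mk => //; edge.
have [dy _ Ny] : [/\ 2 * d y = #|A| + 2, 2 * d a = #|A| + 2 &
    forall w, w \in A -> (e y w || e a w) && (e y w && e a w ==> (w \in [:: b; c]))].
  by apply: (@clique5_minus_edge_tight y x) => //; apply: mk; rewrite // 1?e_sym // eq_sym.
(* [a] has degree at least 5, hence a further neighbour; tightness makes it the third independent
   vertex. *)
have [|w [wA ws aw]] := @degree_exists _ e A [:: b; c; x; y] a.
  rewrite !big_cons big_nil ab ac (e_sym a x) (e_sym a y) xa ya /=.
  by clear -da n_gt7; lia.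
have wbc : w \notin [:: b; c] by move: ws; rewrite !inE !negb_or; case/and4P=> -> ->.
have nxw : e x w = false.
  by have /andP[_] := Na _ wA; rewrite aw andbT (negbTE wbc) implybF => /negbTE.
have nyw : e y w = false.
  by have /andP[_] := Ny _ wA; rewrite aw andbT (negbTE wbc) implybF => /negbTE.
have bw : e b w by have /andP[] := Nb _ wA; rewrite nxw.
have cw : e c w by have /andP[] := Nc _ wA; rewrite nxw.
have [/andP[wx wy] /andP[wb wc]] : (w != x) && (w != y) /\ (w != b) && (w != c).
  by move: ws; rewrite !inE !negb_or; case/and4P=> -> -> -> ->.
have [dw _ _] : [/\ 2 * d w = #|A| + 2, 2 * d a = #|A| + 2 &
    forall z, z \in A -> (e w z || e a z) && (e w z && e a z ==> (z \in [:: b; c]))].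
  apply: (@clique5_minus_edge_tight w x) => //; apply: mk; rewrite // 1?e_sym //.
  by rewrite nxw.
have us : uniq [:: a; b; c; x; y; w].
  rewrite /= !inE !negb_or xy !(eq_sym _ w) wx wy !(eq_sym _ x) !(eq_sym _ y).
  by rewrite !(adj_neq ab, adj_neq ac, adj_neq bc, adj_neq xa, adj_neq xb, adj_neq xc,
    adj_neq ya, adj_neq yb, adj_neq yc) wb wc (eq_sym w) adj_neq.
have sA : {subset [:: a; b; c; x; y; w] <= A}.
  by apply/allP; rewrite /= (eA ab) (eA bc) (eA cw) (eA xa) (eA ya) wA.
have := crit us sA isT.
rewrite !(list_degree_cons e_sym e_irr) /list_degree !big_cons !big_nil.
rewrite ab ac bc aw bw cw (e_sym a x) (e_sym a y) (e_sym b x) (e_sym b y) (e_sym c x) (e_sym c y).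
rewrite xa xb xc ya yb yc (negbTE nxy) nxw nyw /= => C.
have {}C := C _; move: C dx dy da db dc dw ex6 n_gt7 n_neq11; clear; lia.
Qed.

Lemma list_degree4 a b c u : list_degree e [:: a; b; c; u] =
  2 * (e a b + e a c + e a u + e b c + e b u + e c u).
Proof.
by rewrite !(list_degree_cons e_sym e_irr) /list_degree !big_cons !big_nil; lia.
Qed.

Lemma min_degree x : x \in A -> #|A| != 6 ->
  sqp_ex #|A| < sqp_ex (#|A| - 1) + d x.
Proof.
move=> xA n6; have us : uniq [:: x] by [].
have sA : {subset [:: x] <= A} by apply/allP; rewrite /= xA.
have := crit us sA isT; rewrite !(list_degree_cons e_sym e_irr) /list_degree.
rewrite !big_cons !big_nil /= => C; have := C _; move: n6; clear; lia.
Qed.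

(** * Residue 1 *)

Section OneModSix.

Variable q : nat.
Hypotheses (q_gt0 : 0 < q) (card_A : #|A| = 6 * q + 1).

Lemma low_degree x : x \in A -> 3 * q + 1 <= d x.
Proof.
move=> xA; have n6 : #|A| != 6 by rewrite card_A; move: q_gt0; clear; lia.
by have := min_degree xA n6; rewrite card_A addnK sqp_ex0 sqp_ex1; clear; lia.
Qed.

(** Deleting the triangle shows that its vertices cannot all have the least degree 3q + 1. *)
Lemma triangle_degree a b c : e a b -> e a c -> e b c ->
  9 * q + 4 <= d a + d b + d c.
Proof.
move=> ab ac bc; have us : uniq [:: a; b; c].
  by rewrite /= !inE negb_or !(adj_neq ab, adj_neq ac, adj_neq bc).
have sA : {subset [:: a; b; c] <= A}.
  by apply/allP; rewrite /= (eA ab) (eA bc) (adj_mem_r bc).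
(* With q = p + 1 the order left is 6p + 4, the form of the closed formulas and never 5. *)
have [p qp] : exists p, q = p.+1 by case: (q) q_gt0 => // p; exists p.
have := crit us sA isT; rewrite !(list_degree_cons e_sym e_irr) /list_degree.
rewrite !big_cons !big_nil card_A ab ac bc /=.
have -> : 6 * q + 1 - 3 = 6 * p + 4 by move: qp; clear; lia.
rewrite sqp_ex1 sqp_ex4 => C; have {}C := C _; subst q; move: C; clear; nia.
Qed.

Lemma four_degree s : uniq s -> {subset s <= A} -> size s = 4 ->
  24 * q + list_degree e s < 2 * \sum_(x <- s) d x.
Proof.
move=> us sA s4.
have [p qp] : exists p, q = p.+1 by case: (q) q_gt0 => // p; exists p.
have := crit us sA; rewrite s4 card_A => /(_ isT).
have -> : 6 * q + 1 - 4 = 6 * p + 3 by move: qp; clear; lia.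
rewrite sqp_ex1 sqp_ex3 => C; have {}C := C _; subst q; move: C; clear.
by set D := \sum_(_ <- _) _; nia.
Qed.

Lemma five_degree s : uniq s -> {subset s <= A} -> size s = 5 ->
  30 * q + list_degree e s < 2 * \sum_(x <- s) d x + 2.
Proof.
move=> us sA s5.
have [p qp] : exists p, q = p.+1 by case: (q) q_gt0 => // p; exists p.
have := crit us sA; rewrite s5 card_A => /(_ isT).
have -> : 6 * q + 1 - 5 = 6 * p + 2 by move: qp; clear; lia.
rewrite sqp_ex1 sqp_ex2 => C; have {}C := C _; subst q; move: C; clear.
by set D := \sum_(_ <- _) _; nia.
Qed.

Lemma sqpath5_uniq a b c u v : sqpath5 e a b c u v ->
  uniq [:: a; b; c; u; v] /\ {subset [:: a; b; c; u; v] <= A}.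
Proof.
case=> [[ab ac bc] [bu cu cv uv] [au av bv]]; split.
  by rewrite /= !inE !negb_or au av bv !(adj_neq ab, adj_neq ac, adj_neq bc, adj_neq bu,
    adj_neq cu, adj_neq cv, adj_neq uv).
by apply/allP; rewrite /= (eA ab) (eA bc) (eA cv) (eA uv) (adj_mem_r uv).
Qed.

(** Codegrees cap [d u + d v] and, by reversal, [d a + d b]. Deleting all five vertices bounds the
    total from below, so the rest falls on [c]. *)
Lemma sqpath5_degree a b c u v : sqpath5 e a b c u v ->
  [/\ 3 * q + 3 <= d c, d u + d v <= 6 * q + 3
    & ~~ e a u -> ~~ e b v -> d u + d v <= 6 * q + 2].
Proof.
move=> P; have [[ab ac bc] [bu cu cv uv] [au av bv]] := P.
have [us sA] := sqpath5_uniq P.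
have le_uv := @codegree_le _ e A [:: a; b; c] u v (fun y _ => sqpath5_ext P (y := y)).
have le_ba := @codegree_le _ e A [:: v; u; c] b a
  (fun y _ => sqpath5_ext (sqpath5_rev P) (y := y)).
have ge5 := five_degree us sA erefl.
move: le_uv le_ba ge5; rewrite !(list_degree_cons e_sym e_irr) /list_degree.
rewrite !big_cons !big_nil card_A (e_sym u b) (e_sym u c) (e_sym v c) (e_sym u a) (e_sym v a).
rewrite (e_sym v b) ab ac bc bu cu cv uv /=.
case eau: (e a u); case eav: (e a v); case ebv: (e b v) => /= le_uv le_ba ge5.
  have K : clique5 a b c u v by split; [split; [edge | edge | edge | split; edge] | split; edge].
  by have := clique5_bound K; rewrite card_A; move: ge5 q_gt0; clear; lia.
all: split=> [|| nau nbv] //; by move: le_uv le_ba ge5; clear; lia.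
Qed.

(** With an outside vertex [w] adjacent to [s] and [t], [s] is the middle of one square path and the
    fourth vertex of another: its degree is at least 3q + 3 and at most 3q + 2. *)
Lemma no_clique4 a b c u : ~ clique4 a b c u.
Proof.
move=> K; have [us sA] := clique4_list K; have [ab ac au [bc bu cu]] := K.
have := four_degree us sA erefl; rewrite list_degree4 !big_cons big_nil.
rewrite ab ac au bc bu cu => ge4.
have [|p [r [s [t [w]]]]] := clique4_ext K.
  by rewrite card_A; move: ge4 q_gt0; clear; lia.
case=> [[pr ps pt [rs rt st]]]; rewrite !inE !negb_or => /and4P[wp wr ws wt] w_s w_t.
have P1 : sqpath5 e p r s t w by split; split; edge.
have P2 : sqpath5 e p r t s w by split; split; edge.
have [ds _ _] := sqpath5_degree P1; have [_ ds' _] := sqpath5_degree P2.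
have := low_degree (eA w_s); move: ds ds'; clear; lia.
Qed.

(** An edge [a u] or [b v] would complete a K_4; without both, [d u + d v] is at most twice the
    least degree. *)
Lemma sqpath5_low a b c u v : sqpath5 e a b c u v ->
  d u = 3 * q + 1 /\ d v = 3 * q + 1.
Proof.
move=> P; have [[ab ac bc] [bu cu cv uv] [au av bv]] := P.
have [_ _ le2] := sqpath5_degree P.
have nau : ~~ e a u.
  by apply/negP => eau; apply: (@no_clique4 a b c u); split; [edge|edge|edge|split; edge].
have nbv : ~~ e b v.
  by apply/negP => ebv; apply: (@no_clique4 b c u v); split; [edge|edge|edge|split; edge].
move: (le2 nau nbv) (low_degree (eA uv)) (low_degree (adj_mem_r uv)); clear; lia.
Qed.

Lemma one_mod_six_false : False.
Proof.
have bool1 (b : bool) : (b : nat) <= 1 by case: b.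
have [x xA] : exists x, x \in A by apply/card_gt0P; rewrite card_A; lia.
have [|y [yA _ xy]] := @degree_exists _ e A [::] x.
  by rewrite big_nil; move: (low_degree xA); clear; lia.
have [|z [zA _ xz yz]] := @codegree_exists _ e A [::] x y.
  by rewrite big_nil card_A; move: (low_degree xA) (low_degree yA); clear; lia.
have [h [hA hh]] : exists h, h \in A /\ 3 * q + 2 <= d h.
  case: (leqP (3 * q + 2) (d x)) => hx; first by exists x.
  case: (leqP (3 * q + 2) (d y)) => hy; first by exists y.
  exists z; split=> //.
  by move: (triangle_degree xy xz yz) hx hy; clear; lia.
(* The degrees of [h] and [u] sum to at least [#|A| + 2]. *)
have two_common u w : e h u -> exists v, [/\ v != w, e h v & e u v].
  move=> hu; have [|v [vA]] := @codegree_exists _ e A [:: w] h u.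
    rewrite card_A big_cons big_nil addn0; have uA := adj_mem_r hu.
    by move: (low_degree uA) hh (bool1 (e h w && e u w)); clear; lia.
  by rewrite inE => vw hv uv; exists v.
have [|u [uA _ hu]] := @degree_exists _ e A [::] h.
  by rewrite big_nil; move: hh; clear; lia.
have [v [_ hv uv]] := two_common u h hu.
have [v' [vv' hv' uv']] := two_common u v hu.
have [u' [uu' hu' vu']] := two_common v' u hv'.
have nvv' : ~~ e v v'.
  by apply/negP => E; apply: (@no_clique4 h u v v'); split; [edge|edge|edge|split; edge].
have nuu' : ~~ e u u'.
  by apply/negP => E; apply: (@no_clique4 h u v' u'); split; [edge|edge|edge|split; edge].
have u'v : u' != v by apply: contraNneq nuu' => ->.
(* [v], [u], [v'], [u'] is a path in the neighbourhood of [h]; inserting [h] in the middle gives a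
   square path. *)
have P : sqpath5 e v u h v' u' by split; split; edge.
have [dv' du'] := sqpath5_low P.
have [du dv] := sqpath5_low (sqpath5_rev P).
(* [u] and [v] share only [h] and have degree sum [#|A| + 1], so no vertex misses both; [u'] misses
   [u], hence sees [v]. *)
have vu2 : e v u'.
  apply: negbNE; apply/negP => nvu'.
  have := @codegree_lt _ e A [:: u'; v'; h] u v u' (adj_mem_r hu') nuu' nvu'
    (fun y _ => sqpath5_ext (sqpath5_rev P) (y := y)).
  rewrite !big_cons big_nil (negbTE nuu') (negbTE nvv') andbF card_A du dv.
  by case: (e u h && e v h); clear; lia.
have us : uniq [:: u; v; v'; u'].
  rewrite /= !inE !negb_or (eq_sym u u') (eq_sym v u') uu' u'v (eq_sym v v') vv'.
  by rewrite !(adj_neq uv, adj_neq uv', adj_neq vu').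
have sA : {subset [:: u; v; v'; u'] <= A}.
  by apply/allP; rewrite /= (eA uv) (eA vu2) (eA vu') (adj_mem_r hu').
(* The 4-cycle makes the left side at least 24q + 8, which is the value of the right side. *)
have := four_degree us sA erefl; rewrite list_degree4 !big_cons big_nil.
rewrite uv uv' vu2 vu' du dv dv' du'; clear; lia.
Qed.

End OneModSix.

Lemma critical_false : 6 < #|A| -> False.
Proof.
move=> n_gt6.
have deg x := @min_degree x^~ (negbT (gtn_eqF n_gt6)).
have [q [r [r6 n_eq]]] : exists q r, r < 6 /\ #|A| = 6 * q.+1 + r.
  by exists (#|A| %/ 6).-1, (#|A| %% 6); move: n_gt6; clear; lia.
case: r r6 n_eq => [|[|[|[|[|[|//]]]]]] _ n_eq.
- have q_gt0 : 0 < q by move: n_eq n_gt6; clear; lia.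
  apply: even_false.
  + by rewrite n_eq; clear -q_gt0; lia.
  + by rewrite n_eq; clear; lia.
  + have -> : #|A| - 6 = 6 * q by rewrite n_eq; clear; lia.
    by rewrite n_eq addn0 !sqp_ex0; clear; nia.
  move=> x /deg; have -> : #|A| - 1 = 6 * q + 5 by rewrite n_eq; clear; lia.
  by rewrite n_eq addn0 sqp_ex0 sqp_ex5; clear; nia.
- exact: (@one_mod_six_false q.+1).
- apply: even_false.
  + by rewrite n_eq; clear; lia.
  + by rewrite n_eq; clear; lia.
  + have -> : #|A| - 6 = 6 * q + 2 by rewrite n_eq; clear; lia.
    by rewrite n_eq !sqp_ex2; clear; nia.
  move=> x /deg; have -> : #|A| - 1 = 6 * q.+1 + 1 by rewrite n_eq; clear; lia.
  by rewrite n_eq sqp_ex1 sqp_ex2; clear; nia.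
- apply: min_degree3_false => // x /deg.
  have -> : #|A| - 1 = 6 * q.+1 + 2 by rewrite n_eq; clear; lia.
  by rewrite n_eq sqp_ex2 sqp_ex3; clear; nia.
- apply: min_degree3_false => // x /deg.
  have -> : #|A| - 1 = 6 * q.+1 + 3 by rewrite n_eq; clear; lia.
  by rewrite n_eq sqp_ex3 sqp_ex4; clear; nia.
- apply: min_degree3_false => // x /deg.
  have -> : #|A| - 1 = 6 * q.+1 + 4 by rewrite n_eq; clear; lia.
  by rewrite n_eq sqp_ex4 sqp_ex5; clear; nia.
Qed.

End Critical.

(** * Small orders and the induction *)

Lemma total_degree_seq (T : finType) (e : rel T) (A : {set T}) s :
  uniq s -> A =i s -> total_degree e A = list_degree e s.
Proof.
move=> us As; have -> : A = [set x in s] by apply/setP => x; rewrite inE As.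
rewrite /total_degree big_set_seq //; apply: eq_bigr => x _.
by rewrite /degree big_set_seq.
Qed.

(** More than 12 edges leave at most two non-edges, and the complement of the square of P_6 contains
    two edges in either position, disjoint or meeting. Order 6 is apart since deleting one vertex
    leads to the exceptional order 5. *)
Lemma six_bound (T : finType) (e : rel T) (A : {set T}) :
  symmetric e -> irreflexive e -> sqpath6_free e -> #|A| = 6 -> total_degree e A <= 24.
Proof.
move=> e_sym e_irr free A6; rewrite leqNgt; apply/negP => gt24.
have free8 (s : seq T) a b c d x y : uniq s -> perm_eq s [:: a; b; c; d; x; y] ->
    e a b + e a c + e b c + e b d + e c d + e c x + e d x + e d y + e x y <= 8.
  move=> us ps; have /free : uniq [:: a; b; c; d; x; y] by rewrite -(perm_uniq ps).
  case: (e a b) (e a c) (e b c) (e b d) (e c d) (e c x) (e d x) (e d y) (e x y);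
    by do 8!case.
have [E|] := boolP [exists x in A, [exists y in A, (x != y) && ~~ e x y]]; last first.
  rewrite negb_exists_in => /forall_inP adj.
  have adjA : {in A &, forall a b, a != b -> e a b}.
    move=> a b aA bA ab; have := adj a aA; rewrite negb_exists_in => /forall_inP /(_ b bA).
    by rewrite ab negbK.
  have [us sz] : uniq (enum A) /\ size (enum A) = 6 by rewrite enum_uniq -cardE.
  have sA x : x \in enum A -> x \in A by rewrite mem_enum.
  move: us sz sA; case: (enum A) => [|a [|b [|c [|d [|x [|y [|]]]]]]] //= us _ sA.
  have /negP[] := @free a b c d x y us.
  have M z : z \in [:: a; b; c; d; x; y] -> z \in A := sA z.
  move: us; rewrite !inE !negb_or => /and5P[/and5P[ab ac ad ax ay]].
  case/and4P=> bc bd bx by_ /and3P[cd cx cy] /andP[dx dy] /andP[xy _].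
  by rewrite !adjA //; apply: M; rewrite !inE eqxx ?orbT.
case/exists_inP: E => a aA /exists_inP[b bA /andP[ab nab]].
have [us sz] : uniq (enum (A :\: [set a; b])) /\ size (enum (A :\: [set a; b])) = 4.
  rewrite enum_uniq -cardE cardsD (setIidPr _); last first.
    by apply/subsetP => z; rewrite !inE => /orP[] /eqP->.
  by rewrite A6 cards2 ab.
have sA z : (z \in enum (A :\: [set a; b])) = (z != a) && (z != b) && (z \in A).
  by rewrite mem_enum !inE negb_or.
move: us sz sA; case: (enum _) => [|c [|d [|x [|y [|]]]]] //= us _ sA.
set s := [:: a; b; c; d; x; y].
have us' : uniq s.
  rewrite /s 2!cons_uniq; apply/and3P; split=> //; last first.
    by have := sA b; rewrite eqxx andbF => ->.
  by rewrite in_cons negb_or ab; have := sA a; rewrite eqxx => ->.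
have As : A =i s.
  move=> z; rewrite /s 2!in_cons sA; case: eqVneq => [->|_] //=.
  by case: eqVneq => [->|].
move: gt24; rewrite (total_degree_seq e us' As) /s.
rewrite !(list_degree_cons e_sym e_irr) /list_degree !big_cons !big_nil (negbTE nab).
(* At most one pair besides {a, b} is a non-edge, and every such pair is at
   distance at least 3 in one of these orders, as is {a, b} in all of them. *)
have P t : (forall p : pred T, count p s = count p t) -> perm_eq s t by move/permP.
have O1 : perm_eq s [:: a; c; x; b; d; y] by apply: P => p /=; clear; lia.
have O2 : perm_eq s [:: a; d; y; b; c; x] by apply: P => p /=; clear; lia.
have O3 : perm_eq s [:: b; c; x; a; d; y] by apply: P => p /=; clear; lia.
have O4 : perm_eq s [:: b; d; y; a; c; x] by apply: P => p /=; clear; lia.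
have O5 : perm_eq s [:: a; c; d; b; x; y] by apply: P => p /=; clear; lia.
move: (free8 _ _ _ _ _ _ _ us' O1) (free8 _ _ _ _ _ _ _ us' O2).
move: (free8 _ _ _ _ _ _ _ us' O3) (free8 _ _ _ _ _ _ _ us' O4).
move: (free8 _ _ _ _ _ _ _ us' O5).
rewrite (e_sym c b) (e_sym c a) (e_sym x b) (e_sym x a) (e_sym d b) (e_sym d a).
rewrite (e_sym x d) (e_sym y a) (e_sym y b) (e_sym y c) /=.
have leb (f : bool) : (f : nat) <= 1 by case: f.
move: (leb (e a c)) (leb (e a d)) (leb (e a x)) (leb (e a y)).
move: (leb (e b c)) (leb (e b d)) (leb (e b x)) (leb (e b y)).
move: (leb (e c d)) (leb (e c x)) (leb (e c y)).
move: (leb (e d x)) (leb (e d y)) (leb (e x y)).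
do 14!move: (nat_of_bool (e _ _)) => ?.
clear; lia.
Qed.

Lemma total_degree_bound (T : finType) (e : rel T) (A : {set T}) :
  symmetric e -> irreflexive e -> sqpath6_free e -> #|A| != 5 ->
  total_degree e A <= 2 * sqp_ex #|A|.
Proof.
have [n] := ubnP #|A|; elim: n => // n IHn in e A *.
rewrite ltnS => le_n e_sym e_irr free n5.
have [n_gt6|n_le6] := ltnP 6 #|A|.
  rewrite leqNgt; apply/negP => gt_ex.
  (* The critical case wants every edge inside [A], so [e] is restricted to [A]. *)
  pose e' x y := [&& e x y, x \in A & y \in A].
  have e'_sym : symmetric e' by move=> x y; rewrite /e' e_sym [(x \in A) && _]andbC.
  have e'_irr : irreflexive e' by move=> x; rewrite /e' e_irr.
  have e'A x y : e' x y -> x \in A by case/and3P.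
  have e'_free : sqpath6_free e'.
    move=> a b c d x y /free; apply: contra.
    by do 8![case/andP=> /and3P[-> _ _]]; case/and3P=> ->.
  have dA : total_degree e' A = total_degree e A.
    by apply: eq_bigr => x xA; apply: eq_bigr => y yA; rewrite /e' xA yA !andbT.
  apply: (critical_false e'_sym e'_irr e'A e'_free _ n_gt6) => s us sA s_gt0 ns5.
  have cardD : #|A :\: [set x in s]| = #|A| - size s.
    rewrite cardsD (setIidPr _) ?card_set_seq //.
    by apply/subsetP => x; rewrite inE => /sA.
  have IH : total_degree e' (A :\: [set y in s]) <= 2 * sqp_ex (#|A| - size s).
    rewrite -cardD; apply: IHn; rewrite ?cardD //.
    by move: s_gt0 n_gt6 le_n; clear; lia.
  have arith t t' l x y D : t + l = t' + 2 * D -> t' <= y -> x < t -> x + l < y + 2 * D.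
    by clear; lia.
  by apply: arith (total_degreeD e'_sym us sA) IH _; rewrite dA.
have [n6|n_neq6] := eqVneq #|A| 6.
  by rewrite n6; apply: (leq_trans (six_bound e_sym e_irr free n6)).
(* Up to order 4 the bound is the size of the complete graph. *)
have : total_degree e A <= #|A| * (#|A| - 1).
  rewrite -sum_nat_const; apply: leq_sum => x xA.
  rewrite /degree (big_setD1 x) //= e_irr (cardsD1 x A) xA addKn -sum1_card.
  by apply: leq_sum => y _; case: (e x y).
move/leq_trans; apply.
by move: n_le6 n_neq6 n5; case: #|A| => [|[|[|[|[|[|[|]]]]]]].
Qed.

(** * From relations to graphs *)

Lemma total_degree_edges (G : sgraph) :
  total_degree (@adj G) [set: G] = 2 * #|edges G|.
Proof.
pose P := [set p : G * G | adj p.1 p.2].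
have -> : total_degree (@adj G) [set: G] = #|P|.
  rewrite /total_degree /degree; under eq_bigr do under eq_bigl do rewrite inE.
  rewrite pair_big -sum1_card [RHS]big_mkcond /=.
  by apply: eq_big => [p|p _]; rewrite !inE //; case: (adj _ _).
have PP p : (p \in P) = adj p.1 p.2 by rewrite inE.
have PE p : p \in P -> [set p.1; p.2] \in edges G.
  by rewrite PP => pP; apply/imset2P; exists p.1 p.2.
(* Each edge is the image of exactly two ordered adjacent pairs. *)
rewrite -sum1_card (partition_big (fun p => [set p.1; p.2]) (mem (edges G))) //=.
rewrite mulnC -sum_nat_const; apply: eq_bigr => E /imset2P[x y _ xyE ->].
have xy : adj x y := xyE.
have xy_neq : x != y by apply: contraTneq xy => ->; rewrite adj_irr.
rewrite sum1_card; transitivity #|[set (x, y); (y, x)]|; last first.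
  by rewrite cards2 xpair_eqE negb_and xy_neq.
apply: eq_card => -[u v]; rewrite !inE !xpair_eqE /=.
apply/andP/orP => [[uv /eqP uvE]|[] /andP[/eqP-> /eqP->]]; last 2 first.
- by rewrite PP eqxx.
- by rewrite PP /= adj_sym setUC eqxx.
rewrite PP /= in uv; rewrite /= in uvE.
have uv_neq : u != v by apply: contraTneq uv => ->; rewrite adj_irr.
have : u \in [set x; y] by rewrite -uvE set21.
have : v \in [set x; y] by rewrite -uvE set22.
rewrite !inE => /orP[] /eqP vE /orP[] /eqP uE; move: uv_neq; rewrite uE vE ?eqxx //.
- by right.
- by left.
Qed.

Lemma sqpath6_freeP (G : sgraph) :
  sqpath6_free (@adj G) <-> ~ has_copy (sqpath 6) G.
Proof.
split=> [free [f [f_inj f_adj]]|nocopy a b c d x y us].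
  pose i k (lt_k : k < 6) : sqpath 6 := Ordinal lt_k.
  have := free (f (i 0 isT)) (f (i 1 isT)) (f (i 2 isT)) (f (i 3 isT)) (f (i 4 isT)) (f (i 5 isT)).
  have us : uniq [:: i 0 isT; i 1 isT; i 2 isT; i 3 isT; i 4 isT; i 5 isT] by [].
  move: us; rewrite -(map_inj_uniq f_inj) => us /(_ us) /negP[].
  by rewrite !f_adj.
apply/negP => K; apply: nocopy.
exists (fun i : 'I_6 => nth a [:: a; b; c; d; x; y] i); split.
  by move=> i j /eqP; rewrite nth_uniq // => /eqP /val_inj.
do 8![case/andP: K => ? K].
case=> i lt_i [j lt_j]; rewrite /= /sqpath_adj /=.
by case: i lt_i => [|[|[|[|[|[|//]]]]]] _; case: j lt_j => [|[|[|[|[|[|//]]]]]] _ //= _;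
  rewrite // adj_sym.
Qed.

(** * The extremal construction *)

Section Construction.

Variables x n : nat.
Hypothesis le_xn : x <= n.

(** Indices below [x] form blocks of three with a common quotient by 3; the others form the
    independent set. Working on [nat] lets degree sums be split as integer ranges. *)
Definition triangles_adj (i j : nat) : bool :=
  ((i < x) != (j < x)) || [&& i < x, j < x, i %/ 3 == j %/ 3 & i != j].

Definition triangles_rel : rel 'I_n := fun i j => triangles_adj i j.

Lemma triangles_sym : symmetric triangles_rel.
Proof.
move=> i j; rewrite /triangles_rel /triangles_adj eq_sym; congr (_ || _).
by rewrite andbCA [j %/ 3 == _]eq_sym [nat_of_ord j == _]eq_sym.
Qed.

Lemma triangles_irr : irreflexive triangles_rel.
Proof. by move=> i; rewrite /triangles_rel /triangles_adj !eqxx !andbF. Qed.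

Definition triangles_graph := SGraph triangles_sym triangles_irr.

(* Removing from the square path any set of vertices that meets each triangle at
   most once leaves a path on four vertices, which does not fit inside a
   triangle. *)
Lemma triangles_free : sqpath6_free triangles_rel.
Proof.
move=> [a la] [b lb] [c lc] [d ld] [u lu] [v lv]; rewrite /= !inE !negb_or -!val_eqE /=.
case/and5P=> /and5P[ab ac ad au av] /and4P[bc bd bu bv] /and3P[cd cu cv] /andP[du dv].
case/andP=> uv _.
have four i j k l : i != j -> i != k -> i != l -> j != k -> j != l -> k != l ->
    i %/ 3 = j %/ 3 -> j %/ 3 = k %/ 3 -> k %/ 3 = l %/ 3 -> False.
  by clear; lia.
apply/negP; rewrite /triangles_rel /triangles_adj /=.
rewrite ab ac bc bd cd cu du dv uv !andbT.
case: (a < x); case: (b < x); case: (c < x); case: (d < x); case: (u < x); case: (v < x) => //=.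
all: rewrite ?andbT ?andbF //=.
all: do ![case/andP=> /eqP ?]; move/eqP=> ?.
(* In each surviving case four vertices are chained by edges inside triangles, hence share a
   block. *)
all: first [ by apply: (four a b c d) => //; congruence | by apply: (four a b c u) => //; congruence
  | by apply: (four a b d u) => //; congruence | by apply: (four a c d u) => //; congruence
  | by apply: (four a c d v) => //; congruence | by apply: (four b c d u) => //; congruence
  | by apply: (four b c d v) => //; congruence | by apply: (four b c u v) => //; congruence ].
Qed.

Lemma triangles_degree_out i : x <= i ->
  x <= \sum_(0 <= j < n) (triangles_adj i j : nat).
Proof.
move=> le_xi; rewrite (big_cat_nat (leq0n x) le_xn) /=.
apply: leq_trans (leq_addr _ _).
rewrite (eq_big_nat _ _ (F2 := fun=> 1)) ?sum_nat_const_nat ?subn0 ?muln1 // => j /andP[_ lt_j].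
by rewrite /triangles_adj lt_j ltnNge le_xi.
Qed.

Lemma triangles_degree_in i : i < x ->
  n - x + \sum_(0 <= j < x) (triangles_adj i j : nat) <=
    \sum_(0 <= j < n) (triangles_adj i j : nat).
Proof.
move=> lt_ix; rewrite (big_cat_nat (leq0n x) le_xn) /= addnC leq_add2l.
rewrite [X in _ <= X](eq_big_nat _ _ (F2 := fun=> 1)) ?sum_nat_const_nat ?muln1 // => j /andP[le_j _].
by rewrite /triangles_adj lt_ix [j < x]ltnNge le_j.
Qed.

(** The bound on [i] says that its block, which starts at [k], is complete. *)
Lemma triangles_degree_block i : i < x %/ 3 * 3 ->
  2 <= \sum_(0 <= j < x) (triangles_adj i j : nat).
Proof.
move=> lt_i; set k := i %/ 3 * 3.
have le1 : k <= k + 3 by rewrite leq_addr.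
have le2 : k + 3 <= x by move: lt_i; rewrite /k; clear; lia.
rewrite (big_cat_nat (leq0n k) (leq_trans le1 le2)) (big_cat_nat le1 le2) /=.
apply: leq_trans (leq_addl _ _); apply: leq_trans (leq_addr _ _).
rewrite addn3 !big_nat_recl // ?big_geq //; try by rewrite /k; clear; lia.
rewrite /triangles_adj.
have -> : i < x by move: lt_i; clear; lia.
have [-> -> ->] : [/\ k < x, k.+1 < x & k.+2 < x] by move: le2; clear; split; lia.
have [-> -> ->] : [/\ k %/ 3 = i %/ 3, k.+1 %/ 3 = i %/ 3 & k.+2 %/ 3 = i %/ 3].
  by rewrite /k; clear; split; lia.
rewrite eqxx /=; have : i = k \/ i = k.+1 \/ i = k.+2 by rewrite /k; clear; lia.
by case=> [->|[]->]; clear; lia.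
Qed.

(** Degrees are summed over the complete blocks, the rest of the first part, and the independent
    set. *)
Lemma triangles_edges : x * (n - x) + x %/ 3 * 3 <= #|edges triangles_graph|.
Proof.
have T : \sum_(0 <= i < n) \sum_(0 <= j < n) (triangles_adj i j : nat) =
    2 * #|edges triangles_graph|.
  rewrite -total_degree_edges /total_degree big_mkord.
  apply: eq_big => [i|i _]; first by rewrite inE.
  rewrite big_mkord; apply: eq_bigl => j; by rewrite inE.
rewrite -(leq_pmul2l (isT : 0 < 2)) -T; set k := x %/ 3 * 3.
have le_k : k <= x by apply: leq_trunc_div.
rewrite (big_cat_nat (leq0n x) le_xn) /= (big_cat_nat (leq0n k) le_k) /=.
have B1 : k * (n - x + 2) <= \sum_(0 <= i < k) \sum_(0 <= j < n) (triangles_adj i j : nat).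
  rewrite -[X in X * _](subn0 k) -sum_nat_const_nat big_nat [X in _ <= X]big_nat.
  apply: leq_sum => i /andP[_ lt_i]; apply: leq_trans (triangles_degree_in _).
    by rewrite leq_add2l triangles_degree_block.
  exact: leq_trans lt_i le_k.
have B2 : (x - k) * (n - x) <=
    \sum_(k <= i < x) \sum_(0 <= j < n) (triangles_adj i j : nat).
  rewrite -sum_nat_const_nat big_nat [X in _ <= X]big_nat.
  apply: leq_sum => i /andP[_ lt_i]; apply: leq_trans (triangles_degree_in lt_i).
  exact: leq_addr.
have B3 : (n - x) * x <= \sum_(x <= i < n) \sum_(0 <= j < n) (triangles_adj i j : nat).
  rewrite -sum_nat_const_nat big_nat [X in _ <= X]big_nat.
  by apply: leq_sum => i /andP[le_i _]; apply: triangles_degree_out.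
apply: leq_trans (leq_add (leq_add B1 B2) B3).
by move: (n - x) le_k; clear; nia.
Qed.

End Construction.

(** [x] is taken near n/2 with remainder 0 or 1 modulo 3, so that the first part is made of
    triangles and at most one isolated vertex. *)
Lemma sqp_ex_parts n : exists2 x, x <= n & sqp_ex n = x * (n - x) + x %/ 3 * 3.
Proof.
have [q [r [r6 ->]]] : exists q r, r < 6 /\ n = 6 * q + r.
  by exists (n %/ 6), (n %% 6); lia.
case: r r6 => [|[|[|[|[|[|//]]]]]] _; rewrite ?addn0.
- exists (3 * q); first by lia.
  by rewrite sqp_ex0 (_ : 6 * q - 3 * q = 3 * q); [nia | lia].
- exists (3 * q); first by lia.
  by rewrite sqp_ex1 (_ : 6 * q + 1 - 3 * q = 3 * q + 1); [nia | lia].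
- exists (3 * q + 1); first by lia.
  by rewrite sqp_ex2 (_ : 6 * q + 2 - (3 * q + 1) = 3 * q + 1); [nia | lia].
- exists (3 * q + 3); first by lia.
  by rewrite sqp_ex3 (_ : 6 * q + 3 - (3 * q + 3) = 3 * q); [nia | lia].
- exists (3 * q + 3); first by lia.
  by rewrite sqp_ex4 (_ : 6 * q + 4 - (3 * q + 3) = 3 * q + 1); [nia | lia].
- exists (3 * q + 3); first by lia.
  by rewrite sqp_ex5 (_ : 6 * q + 5 - (3 * q + 3) = 3 * q + 2); [nia | lia].
Qed.

Theorem theorem7 (n : nat) (n_gt0 : 0 < n) (n_neq5 : n <> 5) :
  is_ex n (sqpath 6)
    (if n %% 6 \in [:: 1; 2; 3] then n ^ 2 %/ 4 + (n - 1) %/ 2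
     else n ^ 2 %/ 4 + uphalf n).
Proof.
rewrite -/(sqp_ex n).
have upper (G : sgraph) : #|G| = n -> ~ has_copy (sqpath 6) G -> #|edges G| <= sqp_ex n.
  move=> cardG /sqpath6_freeP free; rewrite -(leq_pmul2l (isT : 0 < 2)) -total_degree_edges.
  rewrite -cardG -cardsT; apply: total_degree_bound => //.
  - exact: adj_sym.
  - exact: adj_irr.
  - by rewrite cardsT cardG; apply/eqP.
split=> //; have [x le_xn ex_n] := sqp_ex_parts n.
have nocopy : ~ has_copy (sqpath 6) (triangles_graph x n).
  by apply/sqpath6_freeP; apply: triangles_free.
exists (triangles_graph x n); split=> //; first exact: card_ord.
(* The upper bound applied to the construction turns its edge estimate into an equality. *)
apply/eqP; rewrite eqn_leq upper ?card_ord //= ex_n; exact: triangles_edges.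
Qed.
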